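(* Let $X=(X_n)_{n\in\mathbb{Z}}$ be a stationary and ergodic sequence of integer-valued random variables whose common mean $\mathbb{E}[X_0]\in[-\infty,\infty]$ exists. Let $\mathbb{Z}^R_X$ be the record graph of $X$. \begin{enumerate} \item If $\mathbb{E}[X_0]<0$, then almost surely every connected component of $\mathbb{Z}^R_X$ is of class $\mathcal{F}/\mathcal{F}$. \item If $\mathbb{E}[X_0]>0$, then almost surely $\mathbb{Z}^R_X$ is connected and of class $\mathcal{I}/\mathcal{F}$. \item If $\mathbb{E}[X_0]=0$, then almost surely $\mathbb{Z}^R_X$ is connected and is either of class $\mathcal{I}/\mathcal{F}$ or of class $\mathcal{I}/\mathcal{I}$. \end{enumerate}
   Context: For a sequence $x=(x_n)_{n\in\mathbb{Z}}$ write $y(j,k)=\sum_{l=j}^{k-1}x_l$ for integers $j<k$. The record map is $R_x(i)=\inf\{n>i: y(i,n)\ge 0\}$ if this set is nonempty, and $R_x(i)=i$ otherwise. The record graph $\mathbb{Z}^R_x$ is the directed graph with vertex set $\mathbb{Z}$ and a directed edge $i\to R_x(i)$ for every $i$ with $R_x(i)\neq i$; ''connected'' refers to the underlying undirected graph. For a connected component $C$ of the record graph, two vertices $u,v\in C$ are in the same foil if $R_x^n(u)=R_x^n(v)$ for some $n\ge 1$. The component $C$ is of class $\mathcal{F}/\mathcal{F}$ if it is finite; of class $\mathcal{I}/\mathcal{I}$ if it is infinite and all its foils are infinite; of class $\mathcal{I}/\mathcal{F}$ if it is infinite and all its foils are finite. A connected record graph is said to be of a class if its single component is. *)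

(* Defs.v *)
From HB Require Import structures.
From mathcomp Require Import all_boot all_order all_algebra.
From mathcomp Require Import all_classical all_reals all_analysis.
From Stdlib Require Import Relation_Operators.
Set Implicit Arguments.
Unset Strict Implicit.
Unset Printing Implicit Defensive.
Import Order.TTheory GRing.Theory Num.Theory.
Local Open Scope classical_set_scope.
Local Open Scope ring_scope.

(* y(j,k) = sum_{l=j}^{k-1} x_l   (meaningful for j < k) *)
Definition ysum (x : int -> int) (j k : int) : int :=
  \sum_(t < `|k - j|%N) x (j + t%:Z).

Definition first_record (x : int -> int) (i n : int) : Prop :=
  i < n /\ 0 <= ysum x i n /\ (forall m, i < m -> m < n -> ysum x i m < 0).

Definition Rmap (x : int -> int) (i : int) : int :=
  match pselect (exists n, first_record x i n) with
  | left h => projT1 (cid h)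
  | right _ => i
  end.

Definition radj (x : int -> int) (u v : int) : Prop :=
  (Rmap x u = v /\ Rmap x u <> u) \/ (Rmap x v = u /\ Rmap x v <> v).

Definition rconn (x : int -> int) : int -> int -> Prop :=
  clos_refl_trans int (radj x).

Definition component (x : int -> int) (u : int) : set int := [set v | rconn x u v].

Definition foil (x : int -> int) (u : int) : set int :=
  [set v | rconn x u v /\ exists n : nat, (1 <= n)%N /\ iter n (Rmap x) u = iter n (Rmap x) v].

Definition record_graph_connected (x : int -> int) : Prop := forall u v, rconn x u v.

Definition class_FF (x : int -> int) (u : int) : Prop := finite_set (component x u).
Definition class_II (x : int -> int) (u : int) : Prop :=
  infinite_set (component x u) /\ (forall v, component x u v -> infinite_set (foil x v)).
Definition class_IF (x : int -> int) (u : int) : Prop :=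
  infinite_set (component x u) /\ (forall v, component x u v -> finite_set (foil x v)).

Section Proba.
Context {d : measure_display} {T : measurableType d} {R : realType}.

(* each X n : T -> Z is a random variable (discrete codomain) *)
Definition int_process (X : int -> T -> int) : Prop :=
  forall n k, measurable [set w | X n w = k].

Definition stationary (P : probability T R) (X : int -> T -> int) : Prop :=
  forall (s : seq (int * int)) (k : int),
    P [set w | all (fun p => X (p.1 + k) w == p.2) s] =
    P [set w | all (fun p => X p.1 w == p.2) s].

Definition shift (x : int -> int) : int -> int := fun n => x (n + 1).

Definition cylinders : set (set (int -> int)) :=
  [set A | exists n k, A = [set x | x n = k]].

Definition seq_measurable (A : set (int -> int)) : Prop := <<s cylinders >> A.

Definition path_of (X : int -> T -> int) (w : T) : int -> int := fun n => X n w.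

Definition ergodic (P : probability T R) (X : int -> T -> int) : Prop :=
  forall A : set (int -> int), seq_measurable A ->
    (forall x, A x <-> A (shift x)) ->
    P [set w | A (path_of X w)] = 0%E \/ P [set w | A (path_of X w)] = 1%E.

Definition mean0 (P : probability T R) (X : int -> T -> int) : \bar R :=
  (\int[P]_w ((X 0 w)%:~R : R)%:E)%E.

Definition mean_exists (P : probability T R) (X : int -> T -> int) : Prop :=
  (\int[P]_w (Num.max ((X 0 w)%:~R : R) 0)%:E < +oo)%E \/
  (\int[P]_w (Num.max (- ((X 0 w)%:~R : R)) 0)%:E < +oo)%E.

End Proba.

(* Main.v *)
Require Import Defs.
From HB Require Import structures.
From mathcomp Require Import all_boot all_order all_algebra.
From mathcomp Require Import all_classical all_reals all_analysis.
From mathcomp Require Import measurable_realfun.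
From mathcomp Require Import zify.
From Stdlib Require Import Relation_Operators.
Import Order.TTheory GRing.Theory Num.Theory.
Local Open Scope classical_set_scope.
Local Open Scope ring_scope.

Set Implicit Arguments.
Unset Strict Implicit.
Unset Printing Implicit Defensive.

(* Call [i] a cut if all the sums [y(i, n)], [n > i], are negative, i.e. if [R i = i].
   No edge of the record graph jumps over a cut.  If there is no cut, the orbits of the
   record map cannot cross each other, so they all merge and the graph is connected.

   Write [p] and [q] for the expectations of the positive and negative parts of [X_0].
   The maximal ergodic inequality gives [q <= p] when there is no cut, and sending the
   mass of each integer to the last cut before it gives [P(0 is a cut) + p <= q] when
   there are cuts.  So there are cuts, infinitely many on both sides, exactly when the
   mean is negative; then the components are finite.

   A point of Z selected from [X] in a translation-equivariant way would be uniformly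
   distributed on Z, hence does not exist.  Since the record map has finite fibers, a
   finite foil followed by an infinite one would select such a point, so the foils are
   all finite or all infinite.  If the mean is positive, the maximal inequality for the
   reversed sequence yields a point [j] with [y(i, j) > 0] for all [i < j]; its foil is
   bounded below by [j], and a foil with a minimum is finite because the expected number
   of integers pointing to 0 as to the minimum of their foil is at most 1. *)

(** * Record graphs of deterministic sequences *)

Definition translate (k : int) (x : int -> int) : int -> int := fun n => x (n + k).

Definition cut_at (x : int -> int) (i : int) : Prop := forall m, i < m -> ysum x i m < 0.

(** The time-reversed counterpart of a cut: [past_max x j] says that [- j] is a cut of the sequence
    with terms [- x (- n - 1)]. *)
Definition past_max (x : int -> int) (j : int) : Prop := forall i, i < j -> 0 < ysum x i j.

(** An equivalence relation built from countably many conditions on iterates, hence visibly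
    measurable. It gives the foils when there is no cut, by [foilE]. *)
Definition same_foil (x : int -> int) (u v : int) : Prop :=
  exists n : nat, (1 <= n)%N /\ iter n (Rmap x) u = iter n (Rmap x) v.

Lemma int_ind_ge (Q : int -> Prop) (a : int) :
  Q a -> (forall k, a <= k -> Q k -> Q (k + 1)) -> forall k, a <= k -> Q k.
Proof.
move=> Qa QS k ak; have -> : k = a + `|k - a|%N by lia.
elim: `|k - a|%N => [|n IH]; first by rewrite addr0.
have -> : a + n.+1 = a + n + 1 :> int by lia.
by apply: QS => //; lia.
Qed.

Lemma int_ind_ltn (Q : int -> Prop) (f : int -> nat) :
  (forall k, (forall l, (f l < f k)%N -> Q l) -> Q k) -> forall k, Q k.
Proof.
move=> H k; have [n] := ubnP (f k); elim: n => // n IH in k *.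
by rewrite ltnS => fk; apply: H => l /leq_trans/(_ fk)/IH.
Qed.

Lemma finite_int_setP (A : set int) :
  finite_set A <-> exists N : nat, forall v, A v -> (`|v| <= N)%N.
Proof.
split=> [/finite_seqP[s ->]|[N AN]].
  exists (\max_(v <- s) `|v|%N) => v /= vs.
  by rewrite (big_rem v) //= leq_maxl.
apply: (@sub_finite_set _ _ ((Posz @` `I_N.+1) `|` ((fun n => - Posz n) @` `I_N.+1))).
  move=> v /AN vN /=; have [v0|v0] := lerP 0 v; [left|right];
    exists `|v|%N => /=; lia.
by rewrite finite_setU; split; apply: finite_image; exact: finite_II.
Qed.

Section Heights.
Variable x : int -> int.

Lemma ysumii i : ysum x i i = 0.
Proof. by rewrite /ysum subrr big_ord0. Qed.

Lemma ysumS j k : j <= k -> ysum x j (k + 1) = ysum x j k + x k.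
Proof.
move=> jk; rewrite /ysum.
have -> : `|(k + 1)%R - j|%N = `|k - j|%N.+1 by lia.
by rewrite big_ord_recr /=; congr (_ + _); congr x; lia.
Qed.

Lemma ysum_cat j k l : j <= k -> k <= l -> ysum x j l = ysum x j k + ysum x k l.
Proof.
move=> jk; move: l; apply: int_ind_ge; first by rewrite ysumii addr0.
by move=> l kl IH; rewrite !ysumS ?IH ?addrA//; lia.
Qed.

Lemma first_record_uniq i m n : first_record x i m -> first_record x i n -> m = n.
Proof.
move=> [im [m0 mm]] [i_n [n0 nn]]; apply/eqP; rewrite eq_le; apply/andP; split.
  by rewrite leNgt; apply/negP => nm; have := mm _ i_n nm; lia.
by rewrite leNgt; apply/negP => nm; have := nn _ im nm; lia.
Qed.

Lemma first_record_ex i : ~ cut_at x i -> exists n, first_record x i n.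
Proof.
move=> /existsNP[m] /not_implyP[im] /negP; rewrite -leNgt => m0.
have ex : exists n : nat, 0 <= ysum x i (i + n.+1%:Z).
  by exists (`|m - i|%N.-1); have -> : i + (`|m - i|.-1.+1)%N%:Z = m by lia.
case: (ex_minnP ex) => n n0 nmin; exists (i + n.+1%:Z); split; first by lia.
split=> // l il ln; rewrite ltNge; apply/negP => l0.
have := nmin (`|l - i|%N.-1); have -> : i + (`|l - i|.-1.+1)%N%:Z = l by lia.
by move/(_ l0); lia.
Qed.

Lemma first_record_not_cut i n : first_record x i n -> ~ cut_at x i.
Proof. by move=> [i_n [n0 _]] /(_ n i_n); lia. Qed.

Lemma Rmap_first_record i : ~ cut_at x i -> first_record x i (Rmap x i).
Proof.
move=> /first_record_ex ex; rewrite /Rmap; case: pselect => // h.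
by case: cid.
Qed.

Lemma Rmap_cut i : cut_at x i -> Rmap x i = i.
Proof.
move=> c; rewrite /Rmap; case: pselect => // -[n] /first_record_not_cut //.
Qed.

Lemma Rmap_ge i : i <= Rmap x i.
Proof.
have [c|/Rmap_first_record[/ltW//]] := pselect (cut_at x i).
by rewrite Rmap_cut.
Qed.

(** Gives the graph of the record map as a condition on the sums, from which equivariance and
    measurability follow without opening the choice inside [Rmap]. *)
Lemma RmapE i k : Rmap x i = k <-> first_record x i k \/ (i = k /\ cut_at x i).
Proof.
split=> [<-|[fr|[<- c]]].
- have [c|/Rmap_first_record] := pselect (cut_at x i); last by left.
  by right; rewrite Rmap_cut.
- exact: first_record_uniq (Rmap_first_record (first_record_not_cut fr)) fr.
- exact: Rmap_cut.
Qed.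

(* An edge [u -> R u] jumping over a cut [c] would have height
   S(u) > S(c) > S(R u) >= S(u). *)
Lemma Rmap_cut_le c u : cut_at x c -> (Rmap x u <= c) = (u <= c).
Proof.
move=> cc; apply/idP/idP => [|uc]; first exact: le_trans (Rmap_ge u).
have [->|cu] := eqVneq u c; first by rewrite Rmap_cut.
have [cutu|/Rmap_first_record[uR [R0 Rm]]] := pselect (cut_at x u).
  by rewrite Rmap_cut.
rewrite leNgt; apply/negP => cR.
have := Rm c; have := cc _ cR; rewrite (@ysum_cat u c) in R0; lia.
Qed.

Lemma rconn_cut c u v : cut_at x c -> rconn x u v -> (u <= c) = (v <= c).
Proof.
move=> cc; elim=> [a b [[<- _]|[<- _]]|//|a b e _ -> _ ->//];
  by rewrite Rmap_cut_le.
Qed.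

(** The component is trapped between a cut on each side, since edges do not jump over cuts. *)
Lemma cuts_class_FF u :
  (forall m, exists2 c, m < c & cut_at x c) -> (forall m, exists2 c, c < m & cut_at x c) ->
  class_FF x u.
Proof.
move=> /(_ u)[c uc cc] /(_ u)[b bu cb]; apply/finite_int_setP.
exists (`|b| + `|c|)%N => v uv.
by have := rconn_cut cc uv; have := rconn_cut cb uv; lia.
Qed.

Section NoCut.
Hypothesis nocut : forall i, ~ cut_at x i.

Lemma Rmap_gt i : i < Rmap x i.
Proof. by have [] := Rmap_first_record (nocut (i := i)). Qed.

Lemma Rmap_le i m : i < m -> 0 <= ysum x i m -> Rmap x i <= m.
Proof.
move=> im m0; have [_ [_ fr]] := Rmap_first_record (nocut (i := i)).
by rewrite leNgt; apply/negP => /(fr _ im); lia.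
Qed.

(** Since [y(i, k) < 0 <= y(i, R i)], the sum from [k] to [R i] is positive, so the record of [k]
    comes no later than [R i]. *)
Lemma Rmap_nocross i k : i < k -> k < Rmap x i -> Rmap x k <= Rmap x i.
Proof.
move=> ik kR; apply: Rmap_le => //.
have [iR [R0 fr]] := Rmap_first_record (nocut (i := i)).
by have := fr _ ik kR; rewrite (@ysum_cat i k) in R0; lia.
Qed.

Lemma iter_Rmap_ge n i : i + n%:Z <= iter n (Rmap x) i.
Proof.
elim: n => [|n IH] /=; first by rewrite addr0.
by have := Rmap_gt (iter n (Rmap x) i); lia.
Qed.

(** By [Rmap_nocross] the increasing orbit of [v] cannot jump over [R i], so it lands on it. *)
Lemma iter_Rmap_hit i v : i < v -> v <= Rmap x i ->
  exists n, iter n (Rmap x) v = Rmap x i.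
Proof.
move: v; apply: (@int_ind_ltn _ (fun v => `|Rmap x i - v|%N)) => v IH iv vR.
have [->|nvR] := eqVneq v (Rmap x i); first by exists 0%N.
have vR' : v < Rmap x i by lia.
have := Rmap_nocross iv vR'; have vRv := Rmap_gt v => RR.
have [|||n nE] := IH (Rmap x v); [lia|lia|lia|].
by exists n.+1; rewrite iterSr.
Qed.

(** Advance the smaller point until its next step reaches or passes the larger one; by
    [iter_Rmap_hit] the orbit of the larger point then runs through the landing point. *)
Lemma iter_Rmap_meet u v : exists a b, iter a (Rmap x) u = iter b (Rmap x) v.
Proof.
wlog uv : u v / u <= v.
  move=> H; have [/H//|/ltW/H[a [b ab]]] := lerP u v.
  by exists b, a.
move: u uv; apply: (@int_ind_ltn _ (fun u => `|v - u|%N)) => u IH.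
rewrite le_eqVlt => /orP[/eqP->|uv]; first by exists 0%N, 0%N.
have uR := Rmap_gt u.
have [Rv|/ltW vR] := lerP (Rmap x u) v.
  have [||a [b ab]] := IH (Rmap x u); [lia|lia|].
  by exists a.+1, b; rewrite iterSr.
have [n nE] := iter_Rmap_hit uv vR.
by exists 1%N, n.
Qed.

Lemma rconn_iter n u : rconn x u (iter n (Rmap x) u).
Proof.
elim: n => [|n IH] /=; first exact: rt_refl.
apply: rt_trans IH _; apply: rt_step; left; split=> //.
by apply/eqP; rewrite gt_eqF// Rmap_gt.
Qed.

Lemma rconn_sym u v : rconn x u v -> rconn x v u.
Proof.
elim=> [a b [ab|ab]|a|a b c _ ba _ cb].
- by apply: rt_step; right.
- by apply: rt_step; left.
- exact: rt_refl.
- exact: rt_trans cb ba.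
Qed.

Lemma nocut_connected : record_graph_connected x.
Proof.
move=> u v; have [a [b ab]] := iter_Rmap_meet u v.
apply: rt_trans (rconn_iter a u) _; rewrite ab.
exact/rconn_sym/rconn_iter.
Qed.

Lemma component_infinite u : infinite_set (component x u).
Proof.
move=> /finite_int_setP[N /(_ N.+1%:Z)] /(_ (nocut_connected _ _)); lia.
Qed.

Lemma foilE u : foil x u = [set v | same_foil x u v].
Proof.
by apply/seteqP; split=> v /= => [[]//|]; split=> //; exact: nocut_connected.
Qed.

(* The heights of the preimages of [i] increase strictly with the preimage, and
   they are integers bounded above by the height of [i]. *)
Lemma Rmap_fiber_finite i : finite_set [set v | Rmap x v = i].
Proof.
have fr_i v : Rmap x v = i -> first_record x v i.
  by move=> <-; exact/Rmap_first_record.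
have lo : forall v, Rmap x v = i -> exists b, forall w, Rmap x w = i -> w <= v -> b <= w.
  apply: (@int_ind_ltn _ (fun v => `|ysum x v i|%N)) => v IH vi.
  have [[w [wi wv]]|nw] := pselect (exists w, Rmap x w = i /\ w < v); last first.
    by exists v => w wi _; rewrite leNgt; apply/negP => wv; apply: nw; exists w.
  have [v_i [v0 _]] := fr_i v vi; have [w_i [w0 fr]] := fr_i w wi.
  have wvi : ysum x w i = ysum x w v + ysum x v i by apply: ysum_cat; lia.
  have wv0 := fr _ wv v_i.
  have [||b bP] := IH w; [by lia|by []|].
  exists b => u ui uv; have [uw|wu] := lerP u w; first exact: bP.
  by have := bP w wi (lexx _); lia.
have [[v vi]|nv] := pselect (exists v, Rmap x v = i); last first.
  apply/finite_int_setP; exists 0%N => v vi; exfalso; apply: nv; by exists v.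
have [b bP] := lo v vi.
apply/finite_int_setP; exists (`|b| + `|i| + `|v|)%N => w /= wi.
have := Rmap_gt w; rewrite wi => wi'.
by have [/(bP _ wi)|] := lerP w v; lia.
Qed.

Lemma same_foil_iter n u v : iter n (Rmap x) u = iter n (Rmap x) v -> same_foil x u v.
Proof. by move=> e; exists n.+1; split => //=; rewrite e. Qed.

Lemma same_foil_refl u : same_foil x u u.
Proof. exact: (@same_foil_iter 0). Qed.

Lemma same_foil_sym u v : same_foil x u v -> same_foil x v u.
Proof. by move=> [n [n1 e]]; exists n. Qed.

Lemma same_foil_trans u v w : same_foil x u v -> same_foil x v w -> same_foil x u w.
Proof.
move=> [n [_ e]] [m [_ f]]; apply: (@same_foil_iter (m + n)).
by rewrite iterD e -iterD addnC iterD f -iterD addnC.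
Qed.

Lemma same_foil_Rmap u v : same_foil x u v <-> same_foil x (Rmap x u) (Rmap x v).
Proof.
split=> [[n [_ e]]|[n [_ e]]].
  by apply: (@same_foil_iter n); rewrite -!iterSr /= e.
by apply: (@same_foil_iter n.+1); rewrite !iterSr.
Qed.

Lemma foil_finite_eq u v : same_foil x u v ->
  finite_set [set w | same_foil x u w] -> finite_set [set w | same_foil x v w].
Proof. by move=> uv; apply: sub_finite_set => w /=; exact: same_foil_trans. Qed.

(** The foil of [u] lies in the union of the finite fibers over the foil of [R u]. Hence along an
    orbit the foils can pass from finite to infinite, but never back. *)
Lemma foil_finite_Rmap u : finite_set [set w | same_foil x (Rmap x u) w] ->
  finite_set [set w | same_foil x u w].
Proof.
move=> fin; apply: (@sub_finite_set _ _
    (\bigcup_(i in [set w | same_foil x (Rmap x u) w]) [set v | Rmap x v = i])).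
  by move=> v /= /same_foil_Rmap uv; exists (Rmap x v).
by apply: bigcup_finite => // i _; exact: Rmap_fiber_finite.
Qed.

Lemma foil_finite_iter n u : finite_set [set w | same_foil x (iter n (Rmap x) u) w] ->
  finite_set [set w | same_foil x u w].
Proof. by elim: n => //= n IH /foil_finite_Rmap/IH. Qed.

(** If [u < j] then [y(u, j) > 0], so no step of the orbit of [u] jumps over [j], and [j] is reached
    after [a > 0] steps. With [R^n u = R^n j] this would give [R^(a + n) j = R^n j], against strict
    increase. *)
Lemma past_max_foil j u : past_max x j -> same_foil x j u -> j <= u.
Proof.
move=> pj [n [_ e]]; rewrite leNgt; apply/negP => uj.
suff [a a0 au] : exists2 a, (0 < a)%N & iter a (Rmap x) u = j.
  have : iter (a + n) (Rmap x) j = iter n (Rmap x) j.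
    by rewrite iterD e -iterD addnC iterD au.
  by rewrite iterD; have := iter_Rmap_ge a (iter n (Rmap x) j); lia.
move: u uj {e}; apply: (@int_ind_ltn _ (fun u => `|j - u|%N)) => u IH uj.
have := Rmap_le uj (ltW (pj _ uj)); have uR := Rmap_gt u.
rewrite le_eqVlt => /orP[/eqP<-|Rj]; first by exists 1%N.
have [||a a0 aj] := IH (Rmap x u); [lia|lia|].
by exists a.+1 => //; rewrite iterSr.
Qed.

End NoCut.

(** The point to be selected when finite and infinite foils coexist: the transition from finite to
    infinite singles out a foil, and its maximum singles out a vertex of it. *)
Definition last_finite_foil_max (n : int) : Prop :=
  [/\ forall i, ~ cut_at x i, finite_set [set w | same_foil x n w],
      ~ finite_set [set w | same_foil x (Rmap x n) w] &
      forall w, same_foil x n w -> w <= n].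

(** If [R^a m = R^b n] with [a <= b], then [m] and [R^(b - a) n] share a foil. For [a = b] both
    points are maxima of one foil; for [a < b] finiteness would pass from the foil of [m] back to
    that of [R n]. *)
Lemma last_finite_foil_max_uniq m n :
  last_finite_foil_max m -> last_finite_foil_max n -> m = n.
Proof.
wlog : m n / exists a b, (a <= b)%N /\ iter a (Rmap x) m = iter b (Rmap x) n.
  move=> H mm nn; have [nc _ _ _] := mm; have [a [b ab]] := iter_Rmap_meet nc m n.
  have [le_ab|/ltnW le_ba] := leqP a b; first by apply: H => //; exists a, b.
  by apply/esym; apply: H => //; exists b, a.
move=> [a [b [ab e]]] [nc finm ninfm maxm] [_ finn ninfn maxn].
have mn : same_foil x m (iter (b - a) (Rmap x) n).
  by apply: (@same_foil_iter a); rewrite -iterD subnKC.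
case: (b - a)%N mn => [|k] mn.
  have := maxm _ mn; have /= := maxn m (same_foil_sym mn); lia.
exfalso; apply: ninfn; apply: (@foil_finite_iter nc k); rewrite -iterSr.
exact: foil_finite_eq mn finm.
Qed.

Lemma last_finite_foil_max_ex u v : (forall i, ~ cut_at x i) ->
  finite_set [set w | same_foil x u w] -> ~ finite_set [set w | same_foil x v w] ->
  exists n, last_finite_foil_max n.
Proof.
move=> nc finu infv; have [a [b ab]] := iter_Rmap_meet nc u v.
(* At the meeting point of the two orbits the foil is infinite, otherwise finiteness would pass back
   to [v]. The induction on [a] then locates the transition on the orbit of [u]. *)
have : ~ finite_set [set w | same_foil x (iter a (Rmap x) u) w].
  by rewrite ab => /(@foil_finite_iter nc).
elim: a {ab} => [|a IH] //= infa.
have [fina|/IH//] := pselect (finite_set [set w | same_foil x (iter a (Rmap x) u) w]).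
set z := iter a _ u in infa fina.
have /finite_int_setP[N NP] := fina.
(* The maximum is found by climbing inside the foil, with [k] bounding the distance left to [N].
   Starting from [N + N] suffices because [z] has absolute value at most [N]. *)
have [n zn nmax] : exists2 n, same_foil x z n & forall w, same_foil x z w -> w <= n.
  have zN : (`|N%:Z - z| <= N + N)%N by have /= := NP z (same_foil_refl z); lia.
  have [k kN] : exists k, (`|N%:Z - z| <= k)%N by exists (N + N)%N.
  have := same_foil_refl z; move: {1 3}z kN => y; rewrite -/z in y *.
  elim: k y => [|k IHk] y yk zy.
    by exists y => // w zw; have /= := NP w zw; have /= := NP y zy; lia.
  have [[w [zw yw]]|nw] := pselect (exists w, same_foil x z w /\ y < w).
    by apply: (IHk w) => //; have /= := NP w zw; have /= := NP y zy; lia.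
  exists y => // w zw; rewrite leNgt; apply/negP => yw; apply: nw; by exists w.
exists n; split=> //.
- exact: foil_finite_eq zn fina.
- move=> finn; apply: infa; apply: foil_finite_eq finn.
  by apply: same_foil_sym; have [+ _] := same_foil_Rmap z n; apply.
- by move=> w nw; apply: nmax; exact: same_foil_trans zn nw.
Qed.

End Heights.

(** * Equivariance of the record map and of the foils under translation *)

Section Equivariance.
Variables (k : int) (x : int -> int).

Lemma ysum_translate i n : ysum (translate k x) i n = ysum x (i + k) (n + k).
Proof.
rewrite /ysum /translate; have -> : `|(n + k)%R - (i + k)%R|%N = `|n - i|%N by lia.
by apply: eq_bigr => t _; congr x; lia.
Qed.

Lemma forall_translate (Q : int -> Prop) : (forall m, Q (m + k)) <-> (forall m, Q m).
Proof. by split=> H m //; have := H (m - k); rewrite subrK. Qed.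

Lemma exists_translate (Q : int -> Prop) : (exists m, Q (m + k)) <-> (exists m, Q m).
Proof.
by split=> -[m Qm]; [exists (m + k)|exists (m - k); rewrite subrK].
Qed.

Lemma cut_translate i : cut_at (translate k x) i <-> cut_at x (i + k).
Proof.
rewrite /cut_at -[X in _ <-> X]forall_translate.
by split=> H m; have := H m; rewrite ysum_translate ltrD2r.
Qed.

Lemma past_max_translate i : past_max (translate k x) i <-> past_max x (i + k).
Proof.
rewrite /past_max -[X in _ <-> X]forall_translate.
by split=> H m; have := H m; rewrite ysum_translate ltrD2r.
Qed.

Lemma first_record_translate i n :
  first_record (translate k x) i n <-> first_record x (i + k) (n + k).
Proof.
rewrite /first_record ysum_translate ltrD2r.
rewrite -(forall_translate (fun m => i + k < m -> m < n + k -> ysum x (i + k) m < 0)).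
by split=> -[? [? H]]; do 2!split=> //; move=> m; have := H m;
  rewrite ysum_translate !ltrD2r.
Qed.

Lemma Rmap_translate i : Rmap (translate k x) i = Rmap x (i + k) - k.
Proof.
apply/RmapE; rewrite first_record_translate cut_translate subrK.
have /RmapE[?|[e c]] : Rmap x (i + k) = Rmap x (i + k) by []; [by left|right].
by split=> //; lia.
Qed.

Lemma iter_Rmap_translate n i :
  iter n (Rmap (translate k x)) i = iter n (Rmap x) (i + k) - k.
Proof.
elim: n => [|n IH] /=; first by rewrite addrK.
by rewrite Rmap_translate IH subrK.
Qed.

Lemma same_foil_translate u v :
  same_foil (translate k x) u v <-> same_foil x (u + k) (v + k).
Proof.
split=> -[n [n1 e]]; exists n; split=> //.
  by move: e; rewrite !iter_Rmap_translate => /addIr.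
by rewrite !iter_Rmap_translate e.
Qed.

Lemma foil_finite_translate u :
  finite_set [set w | same_foil (translate k x) u w] <->
  finite_set [set w | same_foil x (u + k) w].
Proof.
rewrite !finite_int_setP; split=> -[N NP]; exists (N + `|k|)%N => v /= uv.
  have := NP (v - k) _; rewrite /= same_foil_translate subrK => /(_ uv); lia.
by have := NP (v + k); rewrite /= -same_foil_translate => /(_ uv); lia.
Qed.

Lemma last_finite_foil_max_translate n :
  last_finite_foil_max (translate k x) n <-> last_finite_foil_max x (n + k).
Proof.
have nc : (forall i, ~ cut_at (translate k x) i) <-> (forall i, ~ cut_at x i).
  rewrite -(forall_translate (fun i => ~ cut_at x i)).
  by split=> H i; [rewrite -cut_translate|rewrite cut_translate]; exact: H.
have mx : (forall w, same_foil (translate k x) n w -> w <= n) <->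
    (forall w, same_foil x (n + k) w -> w <= n + k).
  rewrite -(forall_translate (fun w => same_foil x (n + k) w -> w <= n + k)).
  by split=> H w; have := H w; rewrite same_foil_translate lerD2r.
split=> -[h1 h2 h3 h4]; split.
- exact/nc.
- exact/foil_finite_translate.
- move: h3; rewrite foil_finite_translate Rmap_translate subrK; exact.
- exact/mx.
- exact/nc.
- exact/foil_finite_translate.
- by rewrite foil_finite_translate Rmap_translate subrK.
- exact/mx.
Qed.

End Equivariance.

(** * Countably valued functions and the maximal ergodic inequality *)

Section CountablyValued.
Context {d : measure_display} {T : measurableType d}.

(** For a countable codomain, measurability on points is measurability for the discrete
    sigma-algebra. *)
Definition fibers_measurable {C : countType} (f : T -> C) : Prop :=
  forall c, measurable [set w | f w = c].

Lemma measurable_const_prop (Q : Prop) : measurable [set w : T | Q].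
Proof.
have [q|nq] := pselect Q.
  by rewrite (_ : mkset _ = setT); [exact: measurableT|apply/seteqP; split].
by rewrite (_ : mkset _ = set0); [exact: measurable0|apply/seteqP; split].
Qed.

(** Together with the next rules, this lets the measurability of an event follow the syntax of the
    formula defining it. *)
Lemma measurable_conj (Q Q' : T -> Prop) :
  measurable [set w | Q w] -> measurable [set w | Q' w] ->
  measurable [set w | Q w /\ Q' w].
Proof. exact: measurableI. Qed.

Lemma measurable_disj (Q Q' : T -> Prop) :
  measurable [set w | Q w] -> measurable [set w | Q' w] ->
  measurable [set w | Q w \/ Q' w].
Proof. exact: measurableU. Qed.

Lemma measurable_negation (Q : T -> Prop) :
  measurable [set w | Q w] -> measurable [set w | ~ Q w].
Proof. exact: measurableC. Qed.

Lemma measurable_impl (Q Q' : T -> Prop) :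
  measurable [set w | Q w] -> measurable [set w | Q' w] ->
  measurable [set w | Q w -> Q' w].
Proof.
move=> mQ mQ'; rewrite (_ : mkset _ = [set w | ~ Q w \/ Q' w]).
  by apply: measurable_disj => //; exact: measurable_negation.
apply/seteqP; split=> w /= => [QQ'|[nq /nq[]|//]].
by have [/QQ'|] := pselect (Q w); [right|left].
Qed.

Lemma measurable_ex (C : countType) (Q : C -> T -> Prop) :
  (forall c, measurable [set w | Q c w]) -> measurable [set w | exists c, Q c w].
Proof.
move=> mQ; rewrite (_ : mkset _ = \bigcup_(c : C) [set w | Q c w]).
  exact: countable_bigcupT_measurable.
by apply/seteqP; split=> w /= => [[c Qc]|[c _ Qc]]; exists c.
Qed.

Lemma measurable_all (C : countType) (Q : C -> T -> Prop) :
  (forall c, measurable [set w | Q c w]) -> measurable [set w | forall c, Q c w].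
Proof.
move=> mQ; rewrite (_ : mkset _ = [set w | ~ exists c, ~ Q c w]).
  apply/measurable_negation/measurable_ex => c; exact/measurable_negation.
apply/seteqP; split=> w /= => [Qw [c /(_ (Qw c))]//|/forallNP Qw c].
exact: contrapT (Qw c).
Qed.

Lemma fibers_measurable_pred (C : countType) (f : T -> C) (Q : C -> Prop) :
  fibers_measurable f -> measurable [set w | Q (f w)].
Proof.
move=> mf; rewrite (_ : mkset _ = [set w | exists c, f w = c /\ Q c]).
  apply: measurable_ex => c; apply: measurable_conj => //.
  exact: measurable_const_prop.
by apply/seteqP; split=> w /= => [Qw|[c [<-]]//]; exists (f w).
Qed.

Lemma fibers_measurable_comp (C C' : countType) (h : C -> C') (f : T -> C) :
  fibers_measurable f -> fibers_measurable (fun w => h (f w)).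
Proof. by move=> mf c; exact: (fibers_measurable_pred (fun a => h a = c)). Qed.

Lemma fibers_measurable_pair (C C' : countType) (f : T -> C) (g : T -> C') :
  fibers_measurable f -> fibers_measurable g ->
  fibers_measurable (fun w => (f w, g w)).
Proof.
move=> mf mg [a b]; rewrite (_ : mkset _ = [set w | f w = a /\ g w = b]).
  by apply: measurable_conj.
by apply/seteqP; split=> w /= => [[]|[-> ->]].
Qed.

Lemma fibers_measurable_comp2 (C C' D : countType) (h : C -> C' -> D)
    (f : T -> C) (g : T -> C') :
  fibers_measurable f -> fibers_measurable g ->
  fibers_measurable (fun w => h (f w) (g w)).
Proof.
move=> mf mg.
exact: (fibers_measurable_comp (fun p => h p.1 p.2) (fibers_measurable_pair mf mg)).
Qed.

Lemma fibers_measurable_if (C : countType) (Q : T -> Prop) (f : T -> C) (c0 : C) :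
  measurable [set w | Q w] -> fibers_measurable f ->
  fibers_measurable (fun w => if `[< Q w >] then f w else c0).
Proof.
move=> mQ mf; apply: (fibers_measurable_comp2 (fun (b : bool) c => if b then c else c0)) => //.
case; last first.
  rewrite (_ : mkset _ = [set w | ~ Q w]); first exact: measurable_negation.
  by apply/seteqP; split=> w /=; case: asboolP.
rewrite (_ : mkset _ = [set w | Q w]) //.
by apply/seteqP; split=> w /=; case: asboolP.
Qed.

Context {R : realType}.

(** Expectations are taken of natural-valued functions only, so sums and comparisons hold in the
    extended reals without integrability conditions. *)
Definition nexp (mu : set T -> \bar R) (F : T -> nat) : \bar R :=
  (\int[mu]_w ((F w)%:R : R)%:E)%E.

Lemma measurable_natr (F : T -> nat) : fibers_measurable F ->
  measurable_fun setT (fun w => ((F w)%:R%:E : \bar R)).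
Proof.
move=> mF; apply: (@measurableT_comp _ _ _ _ _ _ (fun n : nat => (n%:R%:E : \bar R)) _ F) => //.
by move=> _ B _; rewrite setTI; exact: (fibers_measurable_pred B).
Qed.

Lemma natr_ge0E (n : nat) : (0 <= (n%:R : R)%:E)%E.
Proof. by rewrite lee_fin. Qed.

Variable mu : {measure set T -> \bar R}.

Lemma nexpD (F G : T -> nat) : fibers_measurable F -> fibers_measurable G ->
  nexp mu (fun w => F w + G w)%N = (nexp mu F + nexp mu G)%E.
Proof.
move=> mF mG; rewrite /nexp -ge0_integralD//.
- by apply: eq_integral => w _; rewrite natrD EFinD.
all: exact: measurable_natr.
Qed.

Lemma le_nexp (F G : T -> nat) : fibers_measurable F -> fibers_measurable G ->
  (forall w, (F w <= G w)%N) -> (nexp mu F <= nexp mu G)%E.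
Proof.
move=> mF mG FG; apply: ge0_le_integral => //.
- exact: measurable_natr.
- exact: measurable_natr.
- by move=> w _; rewrite lee_fin ler_nat.
Qed.

Lemma nexp_ge0 (F : T -> nat) : (0 <= nexp mu F)%E.
Proof. by apply: integral_ge0 => w _; exact: natr_ge0E. Qed.

Lemma nexp_prop (Q : T -> Prop) : measurable [set w | Q w] ->
  nexp mu (fun w => `[< Q w >] : nat) = mu [set w | Q w].
Proof.
by move=> mQ; rewrite -[in RHS](setIT [set w | Q w]) -integral_indic.
Qed.

End CountablyValued.

Section MassPreserving.
Context {d : measure_display} {T : measurableType d} {R : realType}.
Variables (mu : {measure set T -> \bar R}) (theta : T -> T).
Hypothesis mtheta : measurable_fun setT theta.
Hypothesis inv : forall A, measurable A -> mu (theta @^-1` A) = mu A.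

Lemma fibers_measurable_precomp (C : countType) (f : T -> C) :
  fibers_measurable f -> fibers_measurable (f \o theta).
Proof.
by move=> mf c; rewrite -[mkset _]setTI; exact: (mtheta measurableT (mf c)).
Qed.

Lemma nexp_invariant (F : T -> nat) : fibers_measurable F ->
  nexp mu (F \o theta) = nexp mu F.
Proof.
move=> mF; rewrite /nexp.
transitivity (\int[pushforward mu theta]_y ((F y)%:R : R)%:E)%E.
  by rewrite ge0_integral_pushforward//; exact: measurable_natr.
by apply: eq_measure_integral => A mA _; exact: inv.
Qed.

End MassPreserving.

Definition pospartz (z : int) : nat := `|Num.max z 0|%N.
Definition negpartz (z : int) : nat := pospartz (- z).

Section MaximalInequality.
Context {d : measure_display} {T : measurableType d} {R : realType}.
Variables (mu : {measure set T -> \bar R}) (theta : T -> T).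
Hypothesis mtheta : measurable_fun setT theta.
Hypothesis inv : forall A, measurable A -> mu (theta @^-1` A) = mu A.
Variable f : T -> int.
Hypothesis mf : fibers_measurable f.

(** The maximum of the partial sums of [f] along [theta] with at most [n] terms, the empty sum
    included. *)
Fixpoint running_max (n : nat) (w : T) : nat :=
  if n is m.+1 then pospartz (f w + running_max m (theta w)) else 0%N.

Lemma running_max_measurable n : fibers_measurable (running_max n).
Proof.
elim: n => [|n IH] /=; first by move=> c; exact: measurable_const_prop.
exact: (fibers_measurable_comp2 (fun (a : int) (b : nat) => pospartz (a + b%:Z)) mf
  (fibers_measurable_precomp mtheta IH)).
Qed.

Lemma running_max_mono n w : (running_max n w <= running_max n.+1 w)%N.
Proof.
elim: n w => [//|n IH] w; have := IH (theta w); rewrite /= /pospartz; lia.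
Qed.

Lemma nexp_running_max_fin n : (nexp mu (fun w => pospartz (f w)) < +oo)%E ->
  (nexp mu (running_max n) < +oo)%E.
Proof.
move=> fp; elim: n => [|n IH].
  by rewrite /nexp /= integral0_eq// ltry.
have mp : fibers_measurable (fun w => pospartz (f w)) by exact: fibers_measurable_comp.
have mM := fibers_measurable_precomp mtheta (running_max_measurable n).
apply: (@le_lt_trans _ _ (nexp mu (fun w => pospartz (f w) + running_max n (theta w))%N)).
  apply: le_nexp; first exact: running_max_measurable.
    exact: (fibers_measurable_comp2 addn).
  by move=> w /=; rewrite /pospartz; lia.
rewrite nexpD// (nexp_invariant mtheta inv (running_max_measurable n)).
exact: lte_add_pinfty.
Qed.

(** Garsia's argument. Write [M_n] for [running_max n]. Where [f + M_n o theta >= 0], one has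
    [f^- + M_(n+1) = f^+ + M_n o theta], and elsewhere [M_(n+1) = 0]. As [M_n <= M_(n+1)],
    integrating and cancelling the finite, invariant expectation of [M_(n+1)] gives the bound. *)
Lemma maximal_truncated n : (nexp mu (fun w => pospartz (f w)) < +oo)%E ->
  (nexp mu (fun w => if `[< (0 <= f w + running_max n (theta w))%R >]
                     then negpartz (f w) else 0%N)
   <= nexp mu (fun w => pospartz (f w)))%E.
Proof.
move=> fp; set A := (X in nexp mu X).
have mp : fibers_measurable (fun w => pospartz (f w)) by exact: fibers_measurable_comp.
have mM := running_max_measurable n.+1.
have mMt := fibers_measurable_precomp mtheta mM.
have mA : fibers_measurable A.
  apply: fibers_measurable_if; last exact: (fibers_measurable_comp negpartz).
  have mMn := fibers_measurable_precomp mtheta (running_max_measurable n).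
  exact: (fibers_measurable_pred (fun p : int * nat => 0 <= p.1 + p.2)
    (fibers_measurable_pair mf mMn)).
have : (nexp mu (fun w => A w + running_max n.+1 w)%N <=
        nexp mu (fun w => pospartz (f w) + running_max n.+1 (theta w))%N)%E.
  apply: le_nexp; [exact: (fibers_measurable_comp2 addn)..|] => w.
  have := running_max_mono n (theta w); rewrite /A /= /negpartz /pospartz.
  by case: asboolP => [+|/negP]; lia.
rewrite !nexpD// (nexp_invariant mtheta inv mM) leeD2rE//.
by rewrite ge0_fin_numE ?nexp_ge0 ?nexp_running_max_fin.
Qed.

(** The events of [maximal_truncated] increase, and almost every point lies in one of them; monotone
    convergence removes the truncation. [S] is kept abstract to cover both forward sums and negated
    backward sums. *)
Lemma maximal_ergodic_inequality (S : nat -> T -> int) :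
  (forall w, S 0%N w = 0) -> (forall n w, S n.+1 w = f w + S n (theta w)) ->
  {ae mu, forall w, exists n, 0 <= S n.+1 w} ->
  (nexp mu (fun w => pospartz (f w)) < +oo)%E ->
  (nexp mu (fun w => negpartz (f w)) <= nexp mu (fun w => pospartz (f w)))%E.
Proof.
move=> S0 SS ae_rec fp.
have SM n w : S n w <= running_max n w.
  by elim: n w => [|n IH] w; rewrite ?S0//= SS; have := IH (theta w); rewrite /pospartz; lia.
pose g n w := if `[< 0 <= f w + running_max n (theta w) >] then negpartz (f w) else 0%N.
have mg n : fibers_measurable (g n).
  apply: fibers_measurable_if; last exact: (fibers_measurable_comp negpartz).
  have mMn := fibers_measurable_precomp mtheta (running_max_measurable n).
  exact: (fibers_measurable_pred (fun p : int * nat => 0 <= p.1 + p.2)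
    (fibers_measurable_pair mf mMn)).
have g_mono w m n : (m <= n)%N -> (g m w <= g n w)%N.
  elim: n => [|n IH]; first by rewrite leqn0 => /eqP ->.
  rewrite leq_eqVlt => /orP[/eqP->//|/IH/leq_trans]; apply.
  have := running_max_mono n (theta w); rewrite /g /negpartz /pospartz.
  by case: asboolP => [?|/negP]; case: asboolP => [?|/negP]; lia.
pose h n w : \bar R := ((g n w)%:R : R)%:E.
have mh n : measurable_fun setT (h n) by exact: measurable_natr.
have h0 n w : setT w -> (0 <= h n w)%E by move=> _; exact: natr_ge0E.
have h_mono w : setT w -> nondecreasing_seq (h ^~ w).
  by move=> _ m n mn; rewrite lee_fin ler_nat g_mono.
have cvgh w : cvgn (h ^~ w).
  by apply: ereal_nondecreasing_is_cvgn; exact: h_mono.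
have lim_ge n w : (h n w <= limn (h ^~ w))%E.
  by apply: lime_ge; [exact: cvgh|exists n => // m /= nm; exact: h_mono].
apply: (@le_trans _ _ (\int[mu]_w limn (h ^~ w))%E).
  apply: ae_ge0_le_integral => //.
  - by apply: measurable_natr; exact: fibers_measurable_comp.
  - by move=> w _; exact: le_trans (h0 0%N w I) (lim_ge 0%N w).
  - by apply: emeasurable_fun_cvg mh _ => w _; exact: cvgh.
  (* If [S n.+1 w >= 0] then [f w + running_max n (theta w) >= 0], because running maxima dominate
     the partial sums; so [g n w] is already the full negative part. *)
  - apply: filterS ae_rec => w [n Sn] _; apply: le_trans (lim_ge n w).
    rewrite lee_fin ler_nat /g; case: asboolP => // /negP.
    by have := SM n (theta w); rewrite SS in Sn; lia.
rewrite monotone_convergence//; apply: lime_le.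
  apply: ereal_nondecreasing_is_cvgn => m n mn.
  by apply: le_nexp => // w; exact: g_mono.
by apply: nearW => n; exact: maximal_truncated.
Qed.

End MaximalInequality.

(** * The space of integer sequences *)

HB.instance Definition _ := isPointed.Build int 0.
(** Sequences with the sigma-algebra generated by the coordinates; its measurable sets are those of
    [seq_measurable], to which ergodicity refers. *)
Definition pathT : Type := g_sigma_algebraType cylinders.
HB.instance Definition _ := Measurable.on pathT.

Lemma fibers_measurable_coord n : fibers_measurable (fun x : pathT => x n).
Proof. by move=> k; apply: sub_sigma_algebra; exists n, k. Qed.

Lemma measurable_to_path d (T : measurableType d) (f : T -> pathT) :
  (forall n, fibers_measurable (fun w => f w n)) -> measurable_fun setT f.
Proof.
move=> mf; apply: (@measurability _ _ T pathT setT f cylinders) => //.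
by move=> _ [_ [n [k ->]] <-]; rewrite setTI; exact: mf.
Qed.

Lemma translate_measurable k : measurable_fun setT (translate k : pathT -> pathT).
Proof. by apply: measurable_to_path => n; exact: fibers_measurable_coord. Qed.

Lemma ysum_measurable i k : fibers_measurable (fun x : pathT => ysum x i k).
Proof.
rewrite /ysum; elim: `|k - i|%N => [|n IH].
  move=> c; under eq_set do rewrite big_ord0; exact: measurable_const_prop.
move=> c; under eq_set do rewrite big_ord_recr /=.
by move: c; apply: (fibers_measurable_comp2 +%R) => //; exact: fibers_measurable_coord.
Qed.

Lemma cut_measurable i : measurable [set x : pathT | cut_at x i].
Proof.
apply: measurable_all => m; apply: measurable_impl; first exact: measurable_const_prop.
exact: (fibers_measurable_pred (fun z : int => z < 0 : Prop) (ysum_measurable i m)).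
Qed.

Lemma past_max_measurable i : measurable [set x : pathT | past_max x i].
Proof.
apply: measurable_all => m; apply: measurable_impl; first exact: measurable_const_prop.
exact: (fibers_measurable_pred (fun z : int => 0 < z : Prop) (ysum_measurable m i)).
Qed.

Lemma first_record_measurable i n : measurable [set x : pathT | first_record x i n].
Proof.
rewrite /first_record; apply: measurable_conj; first exact: measurable_const_prop.
apply: measurable_conj.
  exact: (fibers_measurable_pred (fun z : int => 0 <= z : Prop) (ysum_measurable i n)).
apply: measurable_all => m; do 2!(apply: measurable_impl; first exact: measurable_const_prop).
exact: (fibers_measurable_pred (fun z : int => z < 0 : Prop) (ysum_measurable i m)).
Qed.

Lemma Rmap_measurable i : fibers_measurable (fun x : pathT => Rmap x i).
Proof.
move=> k; under eq_set do rewrite (propext (RmapE _ _ _)).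
apply: measurable_disj; first exact: first_record_measurable.
by apply: measurable_conj; [exact: measurable_const_prop|exact: cut_measurable].
Qed.

Lemma iter_Rmap_measurable n i : fibers_measurable (fun x : pathT => iter n (Rmap x) i).
Proof.
elim: n => [|n IH] k /=; first exact: measurable_const_prop.
rewrite (_ : mkset _ = [set x | exists a, iter n (Rmap x) i = a /\ Rmap x a = k]).
  apply: measurable_ex => a; apply: measurable_conj; [exact: IH|exact: Rmap_measurable].
by apply/seteqP; split=> x /= => [<-|[a [<-]]//]; exists (iter n (Rmap x) i).
Qed.

Lemma same_foil_measurable u v : measurable [set x : pathT | same_foil x u v].
Proof.
apply: measurable_ex => n; apply: measurable_conj; first exact: measurable_const_prop.
exact: (fibers_measurable_pred (fun p : int * int => p.1 = p.2)
  (fibers_measurable_pair (iter_Rmap_measurable n u) (iter_Rmap_measurable n v))).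
Qed.

Lemma foil_finite_measurable u :
  measurable [set x : pathT | finite_set [set w | same_foil x u w]].
Proof.
under eq_set do rewrite (propext (finite_int_setP _)).
apply: measurable_ex => N; apply: measurable_all => v.
apply: measurable_impl; [exact: same_foil_measurable|exact: measurable_const_prop].
Qed.

Lemma last_finite_foil_max_measurable n :
  measurable [set x : pathT | last_finite_foil_max x n].
Proof.
(* Naming the value [a] of [Rmap x n] turns the foil of a random vertex into a countable union over
   deterministic vertices. *)
rewrite (_ : mkset _ = [set x : pathT | (forall i, ~ cut_at x i) /\
    finite_set [set w | same_foil x n w] /\
    (~ exists a, Rmap x n = a /\ finite_set [set w | same_foil x a w]) /\
    forall w, same_foil x n w -> w <= n]).
  apply: measurable_conj.
    by apply: measurable_all => i; apply: measurable_negation; exact: cut_measurable.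
  apply: measurable_conj; first exact: foil_finite_measurable.
  apply: measurable_conj.
    apply/measurable_negation/measurable_ex => a.
    by apply: measurable_conj; [exact: Rmap_measurable|exact: foil_finite_measurable].
  apply: measurable_all => w; apply: measurable_impl.
    exact: same_foil_measurable.
  exact: measurable_const_prop.
apply/seteqP; split=> x /=.
  by move=> [nc fn infn mx]; do 3!split=> //; move=> [a [<-]].
by move=> [nc [fn [infn mx]]]; split=> // fR; apply: infn; exists (Rmap x n).
Qed.

(** * Equivariant selections *)

Section AlmostEverywhere.
Context {d : measure_display} {T : measurableType d} {R : realType}.
Variable mu : {measure set T -> \bar R}.

Lemma ae_forall_countable (C : countType) (Q : C -> T -> Prop) :
  (forall c, {ae mu, forall w, Q c w}) -> {ae mu, forall w, forall c, Q c w}.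
Proof.
move=> aeQ.
have : {ae mu, forall w, forall n : nat, if unpickle n is Some c then Q c w else True}.
  by apply: ae_foralln => n; case: unpickle => [c|]; [exact: aeQ|exact: aeW].
by apply: filterS => w Qw c; have := Qw (pickle c); rewrite pickleK.
Qed.

Lemma ae_not_measure0 (Q : T -> Prop) : measurable [set w | Q w] -> mu [set w | Q w] = 0 ->
  {ae mu, forall w, ~ Q w}.
Proof.
by move=> mQ Q0; exists [set w | Q w]; split=> // w /= /contrapT.
Qed.

End AlmostEverywhere.

Lemma nneseries_natr_fin (R : realType) (u : nat -> nat) (n : nat) :
  (forall k, (n <= k)%N -> u k = 0%N) ->
  (\sum_(k <oo) ((u k)%:R : R)%:E = ((\sum_(k < n) u k)%N%:R : R)%:E)%E.
Proof.
move=> u0; rewrite (@nneseries_split _ _ 0%N n); last by move=> k _; rewrite lee_fin.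
rewrite add0n eseries0 ?adde0; last by move=> k nk _; rewrite u0.
by rewrite sumEFin -natr_sum big_mkord.
Qed.

Section StationaryPathMeasure.
Context {R : realType}.
Variable mu : {measure set pathT -> \bar R}.
Hypothesis mu1 : mu setT = 1%E.
Hypothesis inv : forall k (A : set pathT), measurable A ->
  mu ((translate k : pathT -> pathT) @^-1` A) = mu A.

Lemma mu_translate k (Q Q' : pathT -> Prop) : measurable [set x | Q x] ->
  (forall x, Q (translate k x) <-> Q' x) -> mu [set x | Q' x] = mu [set x | Q x].
Proof.
move=> mQ QQ'; rewrite -(inv k mQ); congr (mu _).
by apply/seteqP; split=> x /=; rewrite QQ'.
Qed.

Section InDegree.
Variable E : int -> int -> pathT -> Prop.
Hypothesis mE : forall m n, measurable [set x | E m n x].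
Hypothesis E_translate : forall k m n x, E m n (translate k x) <-> E (m + k) (n + k) x.
Hypothesis E_uniq : forall m n n' x, E m n x -> E m n' x -> n = n'.

(* By stationarity the expected in-degree of [n] along a half line equals an expected
   out-degree, which is at most 1, so Borel-Cantelli applies. *)
Lemma half_in_degree_finite (s n : int) : s != 0 ->
  {ae mu, forall x, exists N : nat, forall k : nat, (N <= k)%N -> ~ E (n + k%:Z * s) n x}.
Proof.
move=> s0; pose A (k : nat) := [set x | E (n + k%:Z * s) n x].
pose B (k : nat) := [set x | E n (n - k%:Z * s) x].
have mA k : measurable (A k) by exact: mE.
have mB k : measurable (B k) by exact: mE.
(* Translation by [k * s] carries the edge leaving [n] to the edge entering [n]. *)
have AB k : mu (A k) = mu (B k).
  apply: (@mu_translate (k%:Z * s) (E n (n - k%:Z * s))) => [|x]; first exact: mE.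
  by rewrite E_translate subrK.
have tB : trivIset setT B.
  apply/trivIsetP => i j _ _ ij; apply/seteqP; split=> // x [/= Ei Ej].
  have /addrI/oppr_inj/(mulIf s0)[eij] := E_uniq Ei Ej.
  by rewrite eij eqxx in ij.
have sumA : (\sum_(k <oo) mu (A k) < +oo)%E.
  rewrite (eq_eseriesr (g := fun k => mu (B k))); last by move=> k _; exact: AB.
  have -> : (\sum_(k <oo) mu (B k) = mu (\bigcup_k B k))%E.
    by rewrite measure_bigcup//; apply: eq_eseriesl => k; rewrite in_setT.
  apply: (@le_lt_trans _ _ 1%E); last exact: ltry.
  rewrite -mu1; apply: le_measure => //; rewrite ?inE//.
  exact: bigcupT_measurable.
exists (lim_sup_set A); split.
- apply: bigcapT_measurable => N; exact: bigcup_measurable.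
- exact: lim_sup_set_cvg0.
- move=> x /= /forallNP Ax N _.
  have /existsNP[k /not_implyP[Nk /contrapT Ek]] := Ax N.
  by exists k.
Qed.

Lemma in_degree_finite :
  {ae mu, forall x, forall n, exists N : nat, forall m, E m n x -> (`|m| <= N)%N}.
Proof.
apply: ae_forall_countable => n.
apply: filterS2 (@half_in_degree_finite 1 n isT) (@half_in_degree_finite (-1) n isT).
move=> x [N NP] [M MP]; exists (N + M + `|n|)%N => m Em.
rewrite leqNgt; apply/negP => Nm.
have [nm|mn] := lerP n m.
  by apply: (NP `|m - n|%N); [lia|have -> : n + `|m - n|%N%:Z * 1 = m by lia].
by apply: (MP `|m - n|%N); [lia|have -> : n + `|m - n|%N%:Z * -1 = m by lia].
Qed.

End InDegree.

(* A point of Z selected equivariantly would be uniformly distributed on Z. *)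
Lemma no_equivariant_selection (G : int -> pathT -> Prop) :
  (forall n, measurable [set x | G n x]) ->
  (forall k n x, G n (translate k x) <-> G (n + k) x) ->
  (forall n n' x, G n x -> G n' x -> n = n') ->
  {ae mu, forall x, forall n, ~ G n x}.
Proof.
move=> mG G_translate G_uniq.
(* Let every integer point to the selected one: its in-degree would be infinite. *)
have := @in_degree_finite (fun _ => G) (fun _ => mG) _ _.
move=> /(_ (fun k _ => G_translate k) (fun _ => G_uniq)).
by apply: filterS => x Gx n Gn; have [N /(_ N.+1%:Z Gn)] := Gx n; lia.
Qed.

Lemma no_last_finite_foil :
  {ae mu, forall x, forall n, ~ last_finite_foil_max x n}.
Proof.
apply: (@no_equivariant_selection (fun n x => last_finite_foil_max x n)).
- exact: last_finite_foil_max_measurable.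
- by move=> k n x; exact: last_finite_foil_max_translate.
- by move=> n n' x; exact: last_finite_foil_max_uniq.
Qed.

Definition foil_min (x : int -> int) (m n : int) : Prop :=
  same_foil x m n /\ forall v, same_foil x m v -> n <= v.

(** Let each integer point to the minimum of its foil, when there is one. The vertices pointing to a
    minimum form its whole foil, so the finiteness of in-degrees applies. *)
Lemma foil_with_min_finite :
  {ae mu, forall x, forall n, (forall v, same_foil x n v -> n <= v) ->
    finite_set [set w | same_foil x n w]}.
Proof.
have := @in_degree_finite (fun m n x => foil_min x m n) _ _ _.
have mE m n : measurable [set x : pathT | foil_min x m n].
  apply: measurable_conj; first exact: same_foil_measurable.
  apply: measurable_all => v; apply: measurable_impl; first exact: same_foil_measurable.
  exact: measurable_const_prop.
have E_translate k m n (x : pathT) :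
    foil_min (translate k x) m n <-> foil_min x (m + k) (n + k).
  rewrite /foil_min same_foil_translate.
  rewrite -(forall_translate k (fun v => same_foil x (m + k) v -> n + k <= v)).
  by split=> -[mn H]; split=> // v; have := H v; rewrite same_foil_translate lerD2r.
have E_uniq m n n' (x : pathT) : foil_min x m n -> foil_min x m n' -> n = n'.
  by move=> [mn nmin] [mn' n'min]; have := nmin _ mn'; have := n'min _ mn; lia.
move=> /(_ mE E_translate E_uniq); apply: filterS => x fin n nmin.
have [N NP] := fin n; apply/finite_int_setP; exists N => v nv; apply: NP.
split=> [|w vw]; first exact: same_foil_sym.
by apply: nmin; exact: same_foil_trans nv vw.
Qed.

Lemma no_cut_anywhere : mu [set x | cut_at x 0] = 0 ->
  {ae mu, forall x, forall i, ~ cut_at x i}.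
Proof.
move=> c0; apply: ae_forall_countable => i; apply: ae_not_measure0; first exact: cut_measurable.
rewrite -[RHS]c0; apply: (@mu_translate i (fun x => cut_at x 0)) => [|x].
  exact: cut_measurable.
by rewrite cut_translate add0r.
Qed.

Section Ergodic.
Hypothesis erg : forall A : set pathT, measurable A ->
  (forall x, A x <-> A (translate 1 x)) -> mu A = 0 \/ mu A = 1%E.

Lemma ergodic_ae (Q : pathT -> Prop) : measurable [set x | Q x] ->
  (forall x, Q x <-> Q (translate 1 x)) -> mu [set x | Q x] <> 0 -> {ae mu, forall x, Q x}.
Proof.
move=> mQ invQ Q0; have [//|Q1] := erg mQ invQ.
suff : {ae mu, forall x, ~ ~ Q x} by apply: filterS => x /contrapT.
apply: ae_not_measure0; first exact: measurable_negation.
have -> : [set x | ~ Q x] = setT `\` [set x | Q x] by rewrite setTD.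
rewrite measureD//; last by rewrite [X in (X < _)%E]mu1 ltry.
by rewrite setTI [X in (X - _)%E]mu1 [X in (_ - X)%E]Q1 subee.
Qed.

(** The event that some [i] satisfies [S] is translation invariant and contains the event at [0], so
    its measure is not [0]; ergodicity makes it almost sure. *)
Lemma ae_exists_at (S : (int -> int) -> int -> Prop) :
  (forall i, measurable [set x : pathT | S x i]) ->
  (forall k x i, S (translate k x) i <-> S x (i + k)) ->
  mu [set x | S x 0] <> 0 -> {ae mu, forall x, exists i, S x i}.
Proof.
move=> mS S_translate S0.
have mex : measurable [set x : pathT | exists i, S x i] by exact: measurable_ex.
apply: ergodic_ae => // [x|/eqP].
  rewrite -(exists_translate 1); by split=> -[i Si]; exists i; exact/S_translate.
move=> ex0; apply: S0; apply/eqP; rewrite eq_le measure_ge0 andbT -(eqP ex0).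
by apply: le_measure; rewrite ?inE// => x /= ?; exists 0.
Qed.

(** A greatest or a least cut would be an equivariant selection. So the set of cuts, almost surely
    nonempty by ergodicity, has neither, and is unbounded on both sides. *)
Lemma cuts_two_sided : mu [set x | cut_at x 0] <> 0 ->
  {ae mu, forall x, (forall m, exists2 c, m < c & cut_at x c) /\
                    (forall m, exists2 c, c < m & cut_at x c)}.
Proof.
move=> cut0.
(* The comparison [b] is a parameter so that both directions share measurability and
   equivariance. *)
have mnoc (b : int -> int -> bool) n :
    measurable [set x : pathT | cut_at x n /\ forall m, b n m -> ~ cut_at x m].
  apply: measurable_conj; first exact: cut_measurable.
  apply: measurable_all => m; apply: measurable_impl; first exact: measurable_const_prop.
  by apply: measurable_negation; exact: cut_measurable.
have nocE (b : int -> int -> bool) k n x : (forall m, b n m = b (n + k) (m + k)) ->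
    (cut_at (translate k x) n /\ forall m, b n m -> ~ cut_at (translate k x) m) <->
    (cut_at x (n + k) /\ forall m, b (n + k) m -> ~ cut_at x m).
  move=> bk; rewrite cut_translate.
  rewrite -(forall_translate k (fun m => b (n + k) m -> ~ cut_at x m)).
  by split=> -[c H]; split=> // m; have := H m; rewrite cut_translate bk.
have ae_max : {ae mu, forall x : pathT, forall n,
    ~ (cut_at x n /\ forall m, n < m -> ~ cut_at x m)}.
  apply: no_equivariant_selection => [n|k n x|n n' x [cn nn] [cn' nn']].
  - exact: (mnoc (fun n m => n < m)).
  - by apply: (nocE (fun n m => n < m)) => m; rewrite ltrD2r.
  - have /negP := fun h => nn n' h cn'; have /negP := fun h => nn' n h cn; lia.
have ae_min : {ae mu, forall x : pathT, forall n,
    ~ (cut_at x n /\ forall m, m < n -> ~ cut_at x m)}.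
  apply: no_equivariant_selection => [n|k n x|n n' x [cn nn] [cn' nn']].
  - exact: (mnoc (fun n m => m < n)).
  - by apply: (nocE (fun n m => m < n)) => m; rewrite ltrD2r.
  - have /negP := fun h => nn n' h cn'; have /negP := fun h => nn' n h cn; lia.
have ae_cut := ae_exists_at cut_measurable cut_translate cut0.
apply: filterS2 (filterI ae_max ae_min) ae_cut => x [nomax nomin] [c0 cc0]; split=> m; apply: contrapT => nc.
  have ncm c : cut_at x c -> c <= m.
    by move=> cc; rewrite leNgt; apply/negP => mc; apply: nc; exists c.
  (* If all cuts were at most [m], moving to larger cuts would decrease the distance to [m] and end
     at a greatest cut. The other side is symmetric. *)
  move: c0 cc0; apply: (@int_ind_ltn _ (fun c => `|m - c|%N)) => c IH cc.
  apply: (nomax c); split=> // c' cc' cutc'.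
  by apply: (IH c') => //; have := ncm _ cutc'; lia.
have ncm c : cut_at x c -> m <= c.
  by move=> cc; rewrite leNgt; apply/negP => mc; apply: nc; exists c.
move: c0 cc0; apply: (@int_ind_ltn _ (fun c => `|m - c|%N)) => c IH cc.
apply: (nomin c); split=> // c' cc' cutc'.
by apply: (IH c') => //; have := ncm _ cutc'; lia.
Qed.

End Ergodic.
End StationaryPathMeasure.

(** * Cuts and the sign of the mean *)

Definition last_cut (x : int -> int) (n c : int) : Prop :=
  cut_at x c /\ c <= n /\ forall m, c < m -> m <= n -> ~ cut_at x m.

Lemma last_cut_translate k x n c :
  last_cut (translate k x) n c <-> last_cut x (n + k) (c + k).
Proof.
rewrite /last_cut cut_translate lerD2r.
rewrite -(forall_translate k (fun m => c + k < m -> m <= n + k -> ~ cut_at x m)).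
by split=> -[? [? H]]; do 2!split=> //; move=> m; have := H m;
  rewrite cut_translate ltrD2r lerD2r.
Qed.

Lemma last_cut_measurable n c : measurable [set x : pathT | last_cut x n c].
Proof.
apply: measurable_conj; first exact: cut_measurable.
apply: measurable_conj; first exact: measurable_const_prop.
apply: measurable_all => m; do 2!(apply: measurable_impl; first exact: measurable_const_prop).
by apply: measurable_negation; exact: cut_measurable.
Qed.

Lemma last_cut_uniq x n c c' : last_cut x n c -> last_cut x n c' -> c = c'.
Proof.
move=> [cc [cn mc]] [cc' [cn' mc']].
have [lt|lt|//] := ltrgtP c c'; first by have := mc _ lt cn'.
by have := mc' _ lt cn.
Qed.

Lemma last_cut_ex x n : (forall m, exists2 c, c < m & cut_at x c) ->
  exists k : nat, last_cut x n (n - k%:Z).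
Proof.
move=> /(_ (n + 1))[c cn cc].
have ex : exists k : nat, `[< cut_at x (n - k%:Z) >].
  by exists `|n - c|%N; apply/asboolP; have -> : n - `|n - c|%N%:Z = c by lia.
case: (ex_minnP ex) => k /asboolP ck kmin; exists k; split=> //; split; first by lia.
move=> m km mn cm; have := kmin `|n - m|%N.
have -> : n - `|n - m|%N%:Z = m by lia.
by move=> /(_ _)/wrap[|]; [exact/asboolP|lia].
Qed.

Lemma next_cut_ex x : (forall m, exists2 c, m < c & cut_at x c) ->
  exists2 n : nat, (0 < n)%N /\ cut_at x n &
    forall m : nat, (0 < m < n)%N -> ~ cut_at x m.
Proof.
move=> /(_ 0)[c c0 cc].
have ex : exists n : nat, (0 < n)%N && `[< cut_at x n >].
  exists `|c|%N; apply/andP; split; first by lia.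
  by apply/asboolP; have -> : `|c|%N = c :> int by lia.
case: (ex_minnP ex) => n /andP[n0 /asboolP cn] nmin; exists n => // m /andP[m0 mn] cm.
by have := nmin m; rewrite m0 asboolT//= => /(_ isT); lia.
Qed.

Lemma ysum_pospart_negpart x n :
  ysum x 0 n%:Z = (\sum_(k < n) pospartz (x k%:Z))%N%:Z - (\sum_(k < n) negpartz (x k%:Z))%N%:Z.
Proof.
elim: n => [|n IH]; first by rewrite ysumii !big_ord0.
have -> : n.+1%:Z = n%:Z + 1 by lia.
rewrite ysumS// IH !big_ord_recr /= /negpartz /pospartz; lia.
Qed.

(** The recursion that the maximal inequality asks of [S], along the forward shift; [ysum_rcons] is
    the one along the backward shift. *)
Lemma ysum_cons x n : ysum x 0 n.+1%:Z = x 0 + ysum (translate 1 x) 0 n%:Z.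
Proof.
rewrite ysum_translate (@ysum_cat x 0 1); [|by []|by lia].
have -> : ysum x 0 1 = x 0 by rewrite /ysum big_ord1 addr0.
by congr (_ + ysum _ _ _); lia.
Qed.

Lemma ysum_rcons x n :
  ysum x (- n.+1%:Z) 0 = x (-1) + ysum (translate (-1) x) (- n%:Z) 0.
Proof.
rewrite ysum_translate (@ysum_cat x _ (-1)); [|by lia|by []].
have -> : ysum x (-1) 0 = x (-1) by rewrite /ysum big_ord1 addr0.
rewrite add0r addrC.
by congr (_ + ysum _ _ _); lia.
Qed.

Section MassTransport.
Context {R : realType}.
Variable mu : {measure set pathT -> \bar R}.
Hypothesis mu1 : mu setT = 1%E.
Hypothesis inv : forall k (A : set pathT), measurable A ->
  mu ((translate k : pathT -> pathT) @^-1` A) = mu A.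

Let ae_filter : Filter (nbhs (almost_everywhere mu)) := ae_filter_ringOfSetsType mu.
#[local] Existing Instance ae_filter.

(** The mass that [0] receives from [k]. Only nonnegative integers can have [0] as their last cut,
    hence the index in [nat]. *)
Definition block_mass (g : int -> nat) (k : nat) (x : pathT) : nat :=
  if `[< last_cut x k%:Z 0 >] then g (x k%:Z) else 0%N.

Lemma block_mass_measurable g k : fibers_measurable (block_mass g k).
Proof.
apply: fibers_measurable_if; first exact: last_cut_measurable.
exact: (fibers_measurable_comp g (fibers_measurable_coord _)).
Qed.

(* Each [n] sends the mass [g (x n)] to the last cut before it; by stationarity the
   expected mass sent by 0 is the expected mass received by 0. *)
Lemma mass_transport (g : int -> nat) :
  {ae mu, forall x, forall m, exists2 c, c < m & cut_at x c} ->
  nexp mu (fun x => g (x 0)) =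
  (\int[mu]_x \sum_(k <oo) ((block_mass g k x)%:R : R)%:E)%E.
Proof.
move=> ae_cut.
(* [F k] is the mass that [0] sends to [- k], the translate of what [0] receives from [k]. Exactly
   one [k] has [- k] as the last cut before [0], so these masses add up to [g (x 0)]. *)
pose F (k : nat) (x : pathT) := if `[< last_cut x 0 (0 - k%:Z) >] then g (x 0) else 0%N.
have mF k : fibers_measurable (F k).
  apply: fibers_measurable_if; first exact: last_cut_measurable.
  exact: (fibers_measurable_comp g (fibers_measurable_coord _)).
have FE k : nexp mu (block_mass g k) = nexp mu (F k).
  rewrite -(nexp_invariant (translate_measurable k%:Z) (@inv k%:Z) (mF k)).
  congr (nexp mu _); apply/funext => x; rewrite /F /block_mass /=.
  have -> : translate k%:Z x 0 = x k%:Z by rewrite /translate add0r.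
  have -> // : last_cut (translate k%:Z x) 0 (0 - k%:Z) = last_cut x k%:Z 0.
  by apply/propext; rewrite last_cut_translate add0r subrK.
rewrite integral_nneseries//; last first.
- by move=> k; apply: measurable_natr; exact: block_mass_measurable.
rewrite (eq_eseriesr (g := fun k => nexp mu (F k))); last by move=> k _; exact: FE.
rewrite -integral_nneseries//; last by move=> k; exact: measurable_natr.
apply: ge0_ae_eq_integral => //.
- by apply: measurable_natr; exact: (fibers_measurable_comp g (fibers_measurable_coord _)).
- apply: ge0_emeasurable_sum => // k _; exact: measurable_natr.
- by move=> x _; apply: nneseries_ge0.
apply: filterS ae_cut => x cutx _.
have [k0 ck0] := last_cut_ex 0 cutx.
have F0 k : k <> k0 -> F k x = 0%N.
  rewrite /F; case: asboolP => // ck; have := last_cut_uniq ck ck0; lia.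
rewrite (@nneseries_natr_fin _ (fun k => F k x) k0.+1); last by move=> k ?; apply: F0; lia.
rewrite big_ord_recr /= big1 ?add0n; last by move=> i _; apply: F0; have := ltn_ord i; lia.
by rewrite /F asboolT.
Qed.

(** If [0] is a cut, it receives the masses of [0, ..., n - 1], where [n] is the next cut. The
    integer [y(0, n)] is negative, hence at most [-1], which leaves room for the indicator. If [0]
    is not a cut, it receives nothing. *)
Lemma block_mass_sums (x : pathT) : (forall m, exists2 c, m < c & cut_at x c) ->
  ((`[< cut_at x 0 >] : nat)%:R%:E + \sum_(k <oo) ((block_mass pospartz k x)%:R : R)%:E <=
   \sum_(k <oo) ((block_mass negpartz k x)%:R : R)%:E)%E.
Proof.
move=> /next_cut_ex[n [n0 cn] nocut].
have big g k : (n <= k)%N -> block_mass g k x = 0%N.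
  move=> nk; rewrite /block_mass; case: asboolP => // -[_ [_ lc]].
  by have := lc n%:Z _ _ cn; rewrite ltz_nat lez_nat => /(_ n0 nk).
rewrite (@nneseries_natr_fin R (fun k => block_mass pospartz k x) n); last exact: big.
rewrite (@nneseries_natr_fin R (fun k => block_mass negpartz k x) n); last exact: big.
rewrite -EFinD -natrD lee_fin ler_nat.
case: asboolP => [c0|nc0]; last first.
  rewrite big1 // => i _; rewrite /block_mass; case: asboolP => // -[]//.
have blockE g : \sum_(k < n) block_mass g k x = (\sum_(k < n) g (x k%:Z))%N.
  apply: eq_bigr => i _; rewrite /block_mass asboolT//; split=> //; split=> // m m0 mi.
  have -> : m = `|m|%N by lia.
  by apply: nocut; have := ltn_ord i; lia.
by rewrite !blockE; have := c0 n%:Z; rewrite ysum_pospart_negpart ltz_nat => /(_ n0); lia.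
Qed.

Lemma pospart_cut_le_negpart :
  {ae mu, forall x, (forall m, exists2 c, m < c & cut_at x c) /\
                    (forall m, exists2 c, c < m & cut_at x c)} ->
  (mu [set x | cut_at x 0%R] + nexp mu (fun x => pospartz (x 0%R)) <=
   nexp mu (fun x => negpartz (x 0%R)))%E.
Proof.
move=> ae_cut; have ae_past : {ae mu, forall x, forall m, exists2 c, c < m & cut_at x c}.
  by apply: filterS ae_cut => x [].
rewrite !mass_transport// -(nexp_prop mu (cut_measurable 0)) /nexp.
have msum g : measurable_fun setT
    (fun x => \sum_(k <oo) ((block_mass g k x)%:R%:E : \bar R))%E.
  by apply: ge0_emeasurable_sum => // k _; apply: measurable_natr;
    exact: block_mass_measurable.
have mcut : measurable_fun setT
    (fun x : pathT => ((`[< cut_at x 0 >] : nat)%:R%:E : \bar R)).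
  apply: measurable_natr => c.
  have := @fibers_measurable_if _ pathT nat (fun x => cut_at x 0) (fun _ => 1%N) 0%N
    (cut_measurable 0) (fun _ => measurable_const_prop _) c.
  by congr (measurable _); apply/seteqP; split=> x /=; case: asboolP.
rewrite -ge0_integralD//; last by move=> x _; apply: nneseries_ge0.
apply: ae_ge0_le_integral => //.
- by move=> x _; apply: adde_ge0 => //; apply: nneseries_ge0.
- by apply: emeasurable_funD => //; exact: msum.
- by move=> x _; apply: nneseries_ge0.
apply: filterS ae_cut => x [next _] _; exact: block_mass_sums.
Qed.

(** The maximal inequality for the forward sums: when [0] is not a cut, one of them is
    nonnegative. *)
Lemma negpart_le_pospart : mu [set x | cut_at x 0] = 0 ->
  (nexp mu (fun x => pospartz (x 0%R)) < +oo)%E ->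
  (nexp mu (fun x => negpartz (x 0%R)) <= nexp mu (fun x => pospartz (x 0%R)))%E.
Proof.
move=> cut0; apply: (maximal_ergodic_inequality (translate_measurable 1) (@inv 1)
  (fibers_measurable_coord 0) (S := fun n x => ysum x 0 n%:Z)).
- by move=> x; rewrite ysumii.
- by move=> n x; rewrite ysum_cons.
apply: filterS (ae_not_measure0 (cut_measurable 0) cut0) => x.
move=> /existsNP[m /not_implyP[m0 /negP]]; rewrite -leNgt => S0.
by exists (`|m|%N.-1); have -> : (`|m|%N.-1).+1%:Z = m by lia.
Qed.

(** The maximal inequality for [- x (-1)] along the backward shift. Its partial sums are
    [- y(-n, 0)], one of which is nonnegative when [past_max x 0] fails; the sign change swaps the
    two parts. *)
Lemma pospart_le_negpart : mu [set x | past_max x 0] = 0 ->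
  (nexp mu (fun x => negpartz (x 0%R)) < +oo)%E ->
  (nexp mu (fun x => pospartz (x 0%R)) <= nexp mu (fun x => negpartz (x 0%R)))%E.
Proof.
move=> max0.
have mcoord g n : fibers_measurable (fun x : pathT => g (x n) : nat).
  exact: (fibers_measurable_comp g (fibers_measurable_coord _)).
(* The reversed sums start at index [-1]; stationarity brings the expectations back to index [0]. *)
have shiftE (g : int -> nat) :
    nexp mu (fun x : pathT => g (x (-1))) = nexp mu (fun x : pathT => g (x 0)).
  rewrite -(nexp_invariant (translate_measurable (-1)) (@inv (-1)) (mcoord g 0)).
  by congr (nexp mu _); apply/funext => x /=; rewrite /translate add0r.
have posE : (fun x : pathT => pospartz (x (-1))) = (fun x => negpartz (- x (-1))).
  by apply/funext => x; rewrite /negpartz opprK.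
rewrite -(shiftE negpartz) -(shiftE pospartz) posE.
apply: (maximal_ergodic_inequality (translate_measurable (-1)) (@inv (-1))
  (fibers_measurable_comp -%R (fibers_measurable_coord (-1)))
  (S := fun n x => - ysum x (- n%:Z) 0)).
- by move=> x; rewrite oppr0 ysumii oppr0.
- by move=> n x; rewrite ysum_rcons opprD.
apply: filterS (ae_not_measure0 (past_max_measurable 0) max0) => x.
move=> /existsNP[m /not_implyP[m0 /negP]]; rewrite -leNgt => S0.
exists (`|m|%N.-1); have -> : - (`|m|%N.-1).+1%:Z = m by lia.
by rewrite oppr_ge0.
Qed.

End MassTransport.

(** * Classification *)

Section PathMeasureClasses.
Context {R : realType}.
Variable mu : {measure set pathT -> \bar R}.
Hypothesis mu1 : mu setT = 1%E.
Hypothesis inv : forall k (A : set pathT), measurable A ->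
  mu ((translate k : pathT -> pathT) @^-1` A) = mu A.
Hypothesis erg : forall A : set pathT, measurable A ->
  (forall x, A x <-> A (translate 1 x)) -> mu A = 0 \/ mu A = 1%E.

Let ae_filter : Filter (nbhs (almost_everywhere mu)) := ae_filter_ringOfSetsType mu.
#[local] Existing Instance ae_filter.

Let p := nexp mu (fun x => pospartz (x 0)).
Let q := nexp mu (fun x => negpartz (x 0)).

(** If cuts had probability zero, the maximal inequality would give [q <= p]; [p] is finite because
    it is smaller than [q]. *)
Lemma class_FF_ae : (p < q)%E -> {ae mu, forall x, forall u, class_FF x u}.
Proof.
move=> pq; have cut0 : mu [set x | cut_at x 0] <> 0.
  move=> /negpart_le_pospart; rewrite -/p -/q leNgt pq => /(_ inv) H.
  by have := H (lt_le_trans pq (leey _)).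
apply: filterS (cuts_two_sided mu1 inv erg cut0) => x [next prev] u.
exact: cuts_class_FF.
Qed.

(** With cuts of positive probability, [P(0 is a cut) + p <= q <= p], and the finite [p] cancels. *)
Lemma no_cut_ae : (q <= p)%E -> (q < +oo)%E -> {ae mu, forall x, forall i, ~ cut_at x i}.
Proof.
move=> qp qoo; apply: no_cut_anywhere => //; apply/eqP/negP => /negP/eqP cut0.
have := pospart_cut_le_negpart inv (cuts_two_sided mu1 inv erg cut0); rewrite -/p -/q.
have p_fin : p \is a fin_num.
  rewrite ge0_fin_numE ?nexp_ge0//; apply: le_lt_trans qoo.
  apply: le_trans (pospart_cut_le_negpart inv (cuts_two_sided mu1 inv erg cut0)).
  exact: leeDr.
move=> /le_trans/(_ qp); rewrite -leeBrDr// subee//.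
by rewrite leNgt lt0e measure_ge0 andbT; move/eqP: cut0 => ->.
Qed.

Lemma foils_dichotomy : (q <= p)%E -> (q < +oo)%E ->
  {ae mu, forall x, (forall i, ~ cut_at x i) /\
    ((forall u, finite_set [set w | same_foil x u w]) \/
     (forall u, ~ finite_set [set w | same_foil x u w]))}.
Proof.
move=> qp qoo; apply: filterS2 (no_cut_ae qp qoo) (no_last_finite_foil mu1 inv) => x nocut nolast; split=> //.
have [[u finu]|nofin] := pselect (exists u, finite_set [set w | same_foil x u w]).
  left=> v; apply: contrapT => infv.
  have [n last_n] := last_finite_foil_max_ex nocut finu infv.
  exact: nolast last_n.
by right=> u finu; apply: nofin; exists u.
Qed.

(** The class is read off at the vertex [0], whose component is the whole graph. *)
Lemma class_nonneg_mean_ae : (q <= p)%E -> (q < +oo)%E ->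
  {ae mu, forall x, record_graph_connected x /\ (class_IF x 0 \/ class_II x 0)}.
Proof.
move=> qp qoo; apply: filterS (foils_dichotomy qp qoo) => x [nocut fin].
split; first exact: nocut_connected.
have inf := @component_infinite _ nocut 0.
by case: fin => fin; [left|right]; split=> // v _; rewrite foilE.
Qed.

(** By [pospart_le_negpart] and ergodicity there is almost surely a point [j] with [past_max x j].
    It is the minimum of its foil, so that foil is finite, and the dichotomy extends finiteness to
    all foils. *)
Lemma class_positive_mean_ae : (q < p)%E ->
  {ae mu, forall x, record_graph_connected x /\ class_IF x 0}.
Proof.
move=> qp; have qoo := lt_le_trans qp (leey _).
have max0 : mu [set x | past_max x 0] <> 0.
  by move=> /pospart_le_negpart; rewrite -/p -/q leNgt qp => /(_ inv qoo).
have ae_max := ae_exists_at mu1 erg past_max_measurable past_max_translate max0.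
apply: filterS2 (filterI ae_max (foil_with_min_finite mu1 inv))
  (foils_dichotomy (ltW qp) qoo) => x [[j maxj] fin_min] [nocut fin].
have finj : finite_set [set w | same_foil x j w].
  by apply: fin_min => v; exact: past_max_foil.
split; first exact: nocut_connected.
split=> [|v _]; first exact: component_infinite.
by rewrite foilE//; case: fin => // /(_ j).
Qed.

End PathMeasureClasses.

Lemma pospartzE (R : realDomainType) (z : int) :
  (pospartz z)%:R = Num.max z%:~R 0 :> R.
Proof.
rewrite /pospartz; have [z0|z0] := leP 0 z.
  by rewrite max_l ?ler0z//; case: z z0.
by rewrite max_r// lerz0 ltW.
Qed.

Lemma negpartzE (R : realDomainType) (z : int) :
  (negpartz z)%:R = Num.max (- z%:~R) 0 :> R.
Proof. by rewrite /negpartz pospartzE mulrNz. Qed.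

(** * Transfer from the process to its law on the space of sequences *)

Section Law.
Context {d : measure_display} {T : measurableType d} {R : realType}.
Variables (P : probability T R) (X : int -> T -> int).
Hypothesis mX : int_process X.

Lemma path_of_measurable : measurable_fun setT (path_of X : T -> pathT).
Proof. by apply: measurable_to_path => n k; exact: mX. Qed.

HB.instance Definition _ :=
  isMeasurableFun.Build _ _ _ _ (path_of X : T -> pathT) path_of_measurable.

Definition law := distribution P (path_of X : {mfun T >-> pathT}).

Lemma law1 : law setT = 1%E.
Proof. exact: probability_setT. Qed.

Lemma ae_law (Q : (int -> int) -> Prop) :
  {ae law, forall x, Q x} -> {ae P, forall w, Q (path_of X w)}.
Proof.
move=> [N [mN N0 QN]]; exists (path_of X @^-1` N); split=> //.
  by rewrite -[_ @^-1` _]setTI; exact: path_of_measurable.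
by move=> w /= Qw; apply: QN.
Qed.

Lemma nexp_law (F : pathT -> nat) : fibers_measurable F ->
  nexp law F = nexp P (fun w => F (path_of X w)).
Proof.
move=> mF; rewrite /nexp ge0_integral_distribution//.
exact: measurable_natr.
Qed.

Lemma mean0E : mean0 P X =
  (nexp law (fun x => pospartz (x 0%R)) - nexp law (fun x => negpartz (x 0%R)))%E.
Proof.
have mcoord g : fibers_measurable (fun x : pathT => g (x 0) : nat).
  exact: (fibers_measurable_comp g (fibers_measurable_coord _)).
rewrite /mean0 integralE !nexp_law//; congr (_ - _)%E.
  apply: eq_integral => w _; rewrite funeposE pospartzE.
  by rewrite EFin_max.
apply: eq_integral => w _; rewrite funenegE negpartzE.
by rewrite EFin_max EFinN.
Qed.

Lemma mean_existsE : mean_exists P X ->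
  (nexp law (fun x => pospartz (x 0%R)) < +oo)%E \/
  (nexp law (fun x => negpartz (x 0%R)) < +oo)%E.
Proof.
have mcoord g : fibers_measurable (fun x : pathT => g (x 0) : nat).
  exact: (fibers_measurable_comp g (fibers_measurable_coord _)).
rewrite !nexp_law// /nexp => -[h|h]; [left|right].
  by under eq_integral do rewrite pospartzE.
by under eq_integral do rewrite negpartzE.
Qed.

Lemma law_translate : stationary P X -> forall k (A : set pathT), measurable A ->
  law ((translate k : pathT -> pathT) @^-1` A) = law A.
Proof.
move=> statX k A mA.
(* Stationarity is equality of the two measures on finite-dimensional cylinders. These form a
   pi-system, closed under intersection by concatenating lists, that generates the sigma-algebra, so
   the measures agree. *)
pose G : set (set pathT) := [set B | exists s : seq (int * int),
  B = [set x | all (fun p => x p.1 == p.2) s]].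
have mG B : G B -> measurable B.
  move=> [s ->]; elim: s => [|p s IH] /=; first exact: measurable_const_prop.
  rewrite (_ : mkset _ = [set x | x p.1 = p.2 /\ all (fun p => x p.1 == p.2) s]).
    by apply: measurable_conj => //; exact: fibers_measurable_coord.
  by apply/seteqP; split=> x /= => [/andP[/eqP]|[/eqP-> ->]].
have mtr := @translate_measurable k.
pose tr : {mfun pathT >-> pathT} :=
  HB.pack (translate k : pathT -> pathT) (isMeasurableFun.Build _ _ _ _ _ mtr).
apply: (@measure_unique _ _ pathT G (fun _ => setT) _ _ _ _ (distribution law tr) law) => //.
- apply/seteqP; split.
    apply: smallest_sub; first exact: smallest_sigma_algebra.
    move=> _ [n [c ->]]; apply: sub_sigma_algebra; exists [:: (n, c)].
    by apply/seteqP; split=> x /=; rewrite andbT => /eqP.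
  by apply: smallest_sub; [exact: sigma_algebra_measurable|exact: mG].
- move=> _ _ [s ->] [t ->]; exists (s ++ t).
  by apply/seteqP; split=> x /=; rewrite all_cat => /andP.
- by move=> _; exists [::]; apply/seteqP; split.
- by apply/seteqP; split=> // x _; exists 0%N.
- by move=> _ [s ->]; exact: statX.
- by move=> _; rewrite [X in (X < _)%E]probability_setT ltry.
Qed.

Lemma law_ergodic : ergodic P X -> forall A : set pathT, measurable A ->
  (forall x, A x <-> A (translate 1 x)) -> law A = 0 \/ law A = 1%E.
Proof. by move=> ergX A mA invA; exact: ergX. Qed.

End Law.

Theorem theorem3p6 (d : measure_display) (T : measurableType d) (R : realType)
  (P : probability T R) (X : int -> T -> int) :
  int_process X -> stationary P X -> ergodic P X -> mean_exists P X ->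
  [/\ (mean0 P X < 0)%E ->
        {ae P, forall w, forall u, class_FF (path_of X w) u},
      (0 < mean0 P X)%E ->
        {ae P, forall w, record_graph_connected (path_of X w) /\
                         class_IF (path_of X w) 0} &
      mean0 P X = 0%E ->
        {ae P, forall w, record_graph_connected (path_of X w) /\
                         (class_IF (path_of X w) 0 \/ class_II (path_of X w) 0)}].
Proof.
move=> mX statX ergX /(mean_existsE mX); rewrite (mean0E P mX).
have inv := law_translate mX statX; have erg := law_ergodic mX ergX.
have := class_FF_ae (law1 P mX) inv erg.
have := class_positive_mean_ae (law1 P mX) inv erg.
have := class_nonneg_mean_ae (law1 P mX) inv erg.
have := @nexp_ge0 _ _ R (law P mX) (fun x : pathT => pospartz (x 0)).
have := @nexp_ge0 _ _ R (law P mX) (fun x : pathT => negpartz (x 0)).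
set p := nexp _ (fun x : pathT => pospartz (x 0)); set q := nexp _ (fun x : pathT => negpartz (x 0)).
(* Since [p] or [q] is finite, the sign of [p - q] decides how they compare; a zero difference also
   forces both to be finite. *)
move=> q0 p0 zero pos neg pq; split=> [lt0|gt0|eq0].
- suff /neg/ae_law : (p < q)%E by [].
  move: p q p0 q0 pq lt0 {zero pos neg}.
  by move=> [a||] [b||]//= _ _ [] //; rewrite -?EFinB ?lte_fin ?subr_lt0 ?ltry.
- suff /pos/ae_law : (q < p)%E by [].
  move: p q p0 q0 pq gt0 {zero pos neg}.
  by move=> [a||] [b||]//= _ _ [] //; rewrite -?EFinB ?lte_fin ?subr_gt0 ?ltry.
- suff [qp qoo] : (q <= p)%E /\ (q < +oo)%E by exact: ae_law (zero qp qoo).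
  move: p q p0 q0 pq eq0 {zero pos neg}.
  move=> [a||] [b||]//= _ _ [] // _ []; rewrite ?ltry //.
  all: by move=> /eqP; rewrite subr_eq0 => /eqP ->.
Qed.
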